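(* Let $G$ be a simple graph with vertex set $[n]=\{1,\dots,n\}$ and without isolated vertices, let $S=k[x_1,\dots,x_n]$ be the polynomial ring over a field $k$, let $\{i,j\}$ be an edge of $G$, and let $P=(x_i,x_j)$ be the corresponding prime ideal of $S$. Then $$v_P(J(G))=\deg_G(i)+\deg_G(j)-2-|N_G(i)\cap N_G(j)|+\tau\bigl(G-N_G[\{i,j\}]\bigr).$$
   Context: $S$ is standard graded with degree-$d$ component $S_d$. The cover ideal of $G$ is $J(G)=\bigcap_{\{u,v\}\in E(G)}(x_u,x_v)$. For a nonzero homogeneous ideal $I$ of $S$ and an associated prime $P$ of $I$, the local $v$-number of $I$ at $P$ is $v_P(I)=\min\{d\ge 0 \mid \exists f\in S_d \text{ such that } I:f=P\}$. $N_G(v)$ is the set of neighbors of $v$, $\deg_G(v)=|N_G(v)|$, and for $U\subseteq V(G)$, $N_G(U)=\bigcup_{u\in U}N_G(u)$ and $N_G[U]=U\cup N_G(U)$. $G-U$ is the induced subgraph of $G$ on $V(G)\setminus U$. $\tau(H)$ is the minimum size of a vertex cover of a graph $H$ (with $\tau(H)=0$ if $H$ has no edges). *)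

(* Defs.v *)
From mathcomp Require Import all_boot all_order all_algebra.
From mathcomp Require Import mpoly.

Set Implicit Arguments.
Unset Strict Implicit.
Unset Printing Implicit Defensive.

Import GRing.Theory.
Local Open Scope ring_scope.

(* A simple graph on a finite vertex type T is a symmetric irreflexive
   relation e : rel T, e u v meaning that {u, v} is an edge. *)
Section Graphs.

Variables (T : finType) (e : rel T).

Definition nbr (v : T) : {set T} := [set w | e v w].

(* If u v is an edge, then v is in nbr u but not in nbr v, and vice versa, so
   that deg u and deg v both exceed #|nbr u :&: nbr v| and the truncated
   subtraction deg u + deg v - 2 - #|nbr u :&: nbr v| is an honest one. *)
Definition deg (v : T) : nat := #|nbr v|.

Definition nbrs (U : {set T}) : {set T} := \bigcup_(u in U) nbr u.

Definition closed_nbrs (U : {set T}) : {set T} := U :|: nbrs U.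

Definition isolated (v : T) : bool := nbr v == set0.

Definition vertex_cover (C : {set T}) : bool :=
  [forall u, forall v, e u v ==> (u \in C) || (v \in C)].

Definition tau : nat :=
  #|[arg min_(C < [set: T] | vertex_cover C) #|C| ]|.

(* The vertex type of the graph G - U is the subtype of T of vertices
   outside U. *)
Definition del_vertices (U : {set T}) : rel {x : T | x \notin U} :=
  fun x y => e (val x) (val y).

End Graphs.

Arguments del_vertices [T] e U _ _.

(* [set: T] is a vertex cover, so the default value in tau is harmless and tau
   is the minimum size of a vertex cover. *)
Lemma tauP (T : finType) (e : rel T) :
  (exists2 C : {set T}, vertex_cover e C & #|C| = tau e) /\
  (forall C : {set T}, vertex_cover e C -> (tau e <= #|C|)%N).
Proof.
rewrite /tau; case: arg_minnP => [|C covC minC].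
  by apply/forallP => u; apply/forallP => v; rewrite !inE implybT.
by split; [exists C | exact: minC].
Qed.

(* Ideals are represented by their membership predicates R -> Prop. *)
Section Ideals.

Variable R : comNzRingType.

Definition same_ideal (I J : R -> Prop) : Prop := forall g, I g <-> J g.

Definition ideal2 (a b : R) : R -> Prop :=
  fun g => exists p q : R, g = p * a + q * b.

Definition colon (I : R -> Prop) (f : R) : R -> Prop := fun g => I (g * f).

End Ideals.

Definition is_min (A : nat -> Prop) (m : nat) : Prop :=
  A m /\ forall d, A d -> (m <= d)%N.

Section Polynomials.

Variables (k : fieldType) (n : nat).
Implicit Types I P : {mpoly k[n]} -> Prop.

Definition cover_ideal (e : rel 'I_n) : {mpoly k[n]} -> Prop :=
  fun g => forall u v : 'I_n, e u v ->
    ideal2 ('X_u : {mpoly k[n]}) ('X_v : {mpoly k[n]}) g.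

(* v_P(I) = d. Since the minimum is required to be attained, this includes that
   P is of the form I : f, i.e. for a prime P that P is associated to I. *)
Definition local_v_number I P (d : nat) : Prop :=
  is_min (fun d => exists2 f : {mpoly k[n]},
            f \is d.-homog & same_ideal (colon I f) P) d.

End Polynomials.

Arguments cover_ideal k [n] e _.

(* Main.v *)
(** A polynomial lies in (x_u, x_v) iff each of its monomials is divisible by
    x_u or x_v.  Hence, if J : f = (x_i, x_j), then f has a monomial whose
    support avoids i and j and meets every edge other than {i, j}; conversely,
    the squarefree monomial f on such a set satisfies J : f = (x_i, x_j).  So
    the v-number is the least size of such a set, which must contain all the
    other neighbors of i and j, after which it remains to cover the edges of
    G - N[{i, j}]. *)
Require Import Defs.
From mathcomp Require Import all_boot all_order all_algebra.
From mathcomp Require Import mpoly.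

Import GRing.Theory.
Local Open Scope ring_scope.

Section CoverAllBut.

Variables (T : finType) (e : rel T).
Hypotheses (e_sym : ssrbool.symmetric e) (e_irr : irreflexive e).
Variables (i j : T).
Hypothesis e_ij : e i j.

(** These are the supports of the monomials sought in [f]. Comparing sets exempts the edge {i, j} in
    both orientations. *)
Definition cover_all_but (U : {set T}) : Prop :=
  [/\ i \notin U, j \notin U
    & forall u v, e u v -> [|| u \in U, v \in U | [set u; v] == [set i; j]]].

Let W := closed_nbrs e [set i; j].

(** Being adjacent, [i] and [j] already lie in each other's neighborhoods. *)
Lemma closed_nbrs_edge : W = nbr e i :|: nbr e j.
Proof.
rewrite /W /closed_nbrs /nbrs bigcup_setU !big_set1; apply/setUidPr.
by rewrite subUset !sub1set !inE e_ij e_sym e_ij orbT.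
Qed.

Lemma card_closed_nbrs_edge :
  #|W :\: [set i; j]| = (deg e i + deg e j - 2 - #|nbr e i :&: nbr e j|)%N.
Proof.
have sijW : [set i; j] \subset W by apply: subsetUl.
have i_neq_j : i != j by apply: contraTneq e_ij => ->; rewrite e_irr.
rewrite cardsD (setIidPr sijW) cards2 i_neq_j closed_nbrs_edge cardsU.
by rewrite subnAC.
Qed.

Lemma leq_card_cover_all_but U : cover_all_but U ->
  (#|W :\: [set i; j]| + tau (del_vertices e W) <= #|U|)%N.
Proof.
case=> iU jU covU.
(* An edge from [i] or [j] to a third vertex [w] can only be met at [w]. *)
have sWU : W :\: [set i; j] \subset U.
  apply/subsetP => w; rewrite closed_nbrs_edge !inE negb_or -andbA.
  case/and3P=> wi wj /orP[] e_w; have := covU _ _ e_w.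
    rewrite (negbTE iU) /=; case/orP=> // /eqP/setP/(_ w).
    by rewrite !inE eqxx orbT (negbTE wi) (negbTE wj).
  rewrite (negbTE jU) /=; case/orP=> // /eqP/setP/(_ w).
  by rewrite !inE eqxx orbT (negbTE wi) (negbTE wj).
(* The part of [U] outside [W] covers G - W: an edge there has no end in {i, j}, so it is not the
   exempted one. *)
pose C := [set x : {x : T | x \notin W} | val x \in U].
have covC : vertex_cover (del_vertices e W) C.
  apply/forallP => x; apply/forallP => y; apply/implyP => /covU.
  rewrite !inE orbA => /orP[// | /eqP/setP/(_ (val x))].
  rewrite in_set2 eqxx => /esym xij; case/negP: (valP x).
  by rewrite inE xij.
have [_ /(_ C covC) leC] := tauP (del_vertices e W).
have sCU : val @: C \subset U :\: (W :\: [set i; j]).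
  apply/subsetP => _ /imsetP[x xC ->]; rewrite inE in_setD (negbTE (valP x)).
  by rewrite andbF; rewrite inE in xC.
apply: leq_trans (leq_add (leqnn _) leC) _.
rewrite -(card_imset C val_inj) -(cardsID (W :\: [set i; j]) U).
by rewrite (setIidPr sWU) leq_add2l subset_leq_card.
Qed.

Lemma cover_all_but_exists : exists2 U, cover_all_but U &
  #|U| = (#|W :\: [set i; j]| + tau (del_vertices e W))%N.
Proof.
have [[C covC <-] _] := tauP (del_vertices e W).
have CW x : x \in val @: C -> x \notin W.
  by case/imsetP=> y _ ->; apply: (valP y).
have iW : i \in W by rewrite !inE eqxx.
have jW : j \in W by rewrite !inE eqxx orbT.
(* Edges meeting [W] need no vertex outside it: if [u] is [i] or [j], then [v] is again in [W], so
   it is either in the set or also one of [i], [j]. *)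
have covD u v : e u v -> u \in W ->
    [|| u \in W :\: [set i; j], v \in W :\: [set i; j]
      | [set u; v] == [set i; j]].
  move=> e_uv uW; rewrite !in_setD uW andbT.
  case: (boolP (u \in _)) => //= uij.
  have vW : v \in W.
    by move: e_uv; rewrite closed_nbrs_edge !inE; case/set2P: uij => -> ->; rewrite ?orbT.
  rewrite vW andbT; case: (boolP (v \in _)) => //= vij.
  (* Both ends lie in {i, j} and differ by irreflexivity, so they exhaust it. *)
  rewrite eqEcard subUset !sub1set uij vij /= !cards2.
  by case: (eqVneq u v) e_uv => [->|_ _]; rewrite ?e_irr //; case: (i != j).
exists ((W :\: [set i; j]) :|: val @: C).
  split=> [||u v e_uv].
  - rewrite in_setU in_setD in_set2 eqxx /=.
    by apply: contraL iW; apply: CW.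
  - rewrite in_setU in_setD in_set2 eqxx orbT /=.
    by apply: contraL jW; apply: CW.
  - rewrite !(in_setU _ (W :\: _)).
    have [uW|uW] := boolP (u \in W).
      by case/or3P: (covD _ _ e_uv uW) => ->; rewrite ?orbT.
    have [vW|vW] := boolP (v \in W).
      rewrite e_sym in e_uv; rewrite [[set u; v]]setUC.
      by case/or3P: (covD _ _ e_uv vW) => ->; rewrite ?orbT.
    move/forallP/(_ (Sub u uW))/forallP/(_ (Sub v vW))/implyP/(_ e_uv): covC.
    by case/orP=> /(imset_f val); rewrite SubK => ->; rewrite ?orbT.
rewrite cardsU -(card_imset C val_inj) [X in (_ - X)%N]eq_card0 ?subn0 //.
move=> x; rewrite in_setI in_setD; apply/negP => /andP[/andP[_ xW]] /CW.
by rewrite xW.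
Qed.

End CoverAllBut.

Arguments cover_all_but [T] e i j U.

Section VariableIdeals.

Variables (k : fieldType) (n : nat).
Implicit Types (u v : 'I_n) (g : {mpoly k[n]}) (m : 'X_{1..n}).

Lemma ideal2XP u v g :
  ideal2 ('X_u : {mpoly k[n]}) 'X_v g <->
  {in msupp g, forall m, (m u != 0%N) || (m v != 0%N)}.
Proof.
split=> [[p [q ->]] m|supp_g].
  move/msuppD_le; rewrite mem_cat !(perm_mem (msuppMX _ _)).
  by case/orP=> /mapP[m' _ ->]; rewrite !mnmDE !mnm1E eqxx ?orbT.
have mulX m w : m w != 0%N ->
    (g@_m *: 'X_[m - U_(w)]) * 'X_w = g@_m *: 'X_[m] :> {mpoly k[n]}.
  by move=> mw; rewrite -scalerAl -mpolyXD submK // lep1mP.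
(* Monomials divisible by ['X_u] go to the first cofactor, all others to the second, so that none is
   counted twice. *)
exists (\sum_(m <- msupp g | m u != 0%N) g@_m *: 'X_[m - U_(u)]).
exists (\sum_(m <- msupp g | m u == 0%N) g@_m *: 'X_[m - U_(v)]).
rewrite {1}[g]mpolyE (bigID (fun m : 'X_{1..n} => m u != 0%N)) /= !mulr_suml.
congr (_ + _); first by apply: eq_bigr => m /mulX.
rewrite big_seq_cond [RHS]big_seq_cond; apply: eq_big => m; first by rewrite negbK.
by case/andP=> /supp_g + /negPn mu; rewrite mu /= => mv; rewrite mulX.
Qed.

Lemma ideal2X_set2 u v u' v' g : [set u; v] = [set u'; v'] ->
  ideal2 ('X_u : {mpoly k[n]}) 'X_v g -> ideal2 ('X_u' : {mpoly k[n]}) 'X_v' g.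
Proof.
move/setP=> uv_eq /ideal2XP supp_g; apply/ideal2XP => m /supp_g.
by case/orP=> mw; [have := uv_eq u | have := uv_eq v];
  rewrite !inE eqxx ?orbT => /esym/orP[]/eqP <-; rewrite mw ?orbT.
Qed.

(** Multiplication by ['X_[m]] shifts all exponents by [m]: either [m] supplies [u] or [v] for every
    monomial, or [g] must do so itself. *)
Lemma ideal2XMX u v g m :
  ideal2 ('X_u : {mpoly k[n]}) 'X_v (g * 'X_[m]) <->
  ideal2 ('X_u : {mpoly k[n]}) 'X_v g \/ (m u != 0%N) || (m v != 0%N).
Proof.
rewrite !ideal2XP; split=> [supp_gm | supp_g m'].
  have [|] := boolP (_ || _); [by right | rewrite negb_or !negbK].
  case/andP=> /eqP mu /eqP mv; left=> m' m'g.
  have := supp_gm (m + m')%MM; rewrite (perm_mem (msuppMX _ _)) map_f //.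
  by rewrite !mnmDE mu mv; apply.
rewrite (perm_mem (msuppMX _ _)) => /mapP[m'' m''g ->].
rewrite !mnmDE !addn_eq0 !negb_and; case: supp_g => [/(_ _ m''g)|] /orP[] ->;
  by rewrite ?orbT.
Qed.

Variable e : rel 'I_n.
Hypothesis e_irr : irreflexive e.
Variables i j : 'I_n.
Hypothesis e_ij : e i j.

(** The edge {i, j} alone forces [g] into the prime, as [U] avoids both ends; at every other edge
    the monomial of [U] is already in the edge ideal. *)
Lemma colon_cover_ideal_mesym1 (U : {set 'I_n}) :
  cover_all_but e i j U ->
  same_ideal (colon (cover_ideal k e) 'X_[mesym1 U])
             (ideal2 ('X_i : {mpoly k[n]}) 'X_j).
Proof.
case=> iU jU covU g; split=> [/(_ _ _ e_ij)/ideal2XMX | g_ij u v e_uv].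
  by rewrite !mnmE (negbTE iU) (negbTE jU) => -[].
apply/ideal2XMX; rewrite !mnmE !eqb0 !negbK.
case/or3P: (covU _ _ e_uv) => [->|->|/eqP/esym uv_ij]; rewrite ?orbT; try by right.
by left; apply: ideal2X_set2 g_ij.
Qed.

Lemma colon_cover_ideal_msupp f :
  same_ideal (colon (cover_ideal k e) f) (ideal2 ('X_i : {mpoly k[n]}) 'X_j) ->
  exists2 m, m \in msupp f & cover_all_but e i j [set w | m w != 0%N].
Proof.
move=> colon_f; have i_neq_j : i != j by apply: contraTneq e_ij => ->; rewrite e_irr.
(* Here ['X_w] lies in the colon ideal, and it can be cancelled modulo an edge ideal not involving
   [w]. *)
have cov u v w : e u v -> w \in [set i; j] -> w \notin [set u; v] ->
    ideal2 ('X_u : {mpoly k[n]}) 'X_v f.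
  move=> e_uv w_ij w_uv.
  have /colon_f/(_ u v e_uv) : ideal2 ('X_i : {mpoly k[n]}) 'X_j 'X_w.
    apply/ideal2XP => m /mem_msuppXP <-; rewrite !mnm1E !eqb0 !negbK.
    by rewrite in_set2 in w_ij.
  rewrite mulrC => /ideal2XMX[//|]; rewrite !mnm1E !eqb0 !negbK.
  by move: w_uv; rewrite in_set2 => /negbTE ->.
have cov' u v : e u v -> [set u; v] != [set i; j] ->
    ideal2 ('X_u : {mpoly k[n]}) 'X_v f.
  move=> e_uv; have [sij|/subsetPn[w w_ij w_uv] _] := boolP ([set i; j] \subset [set u; v]).
    by rewrite eq_sym eqEcard sij !cards2 i_neq_j; case: (u == v).
  exact: cov e_uv w_ij w_uv.
(* Otherwise [f] would lie in the ideal of {i, j} too, hence in the cover ideal, and 1 would be in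
   the prime. *)
have /hasP[m mf] : has (fun m : 'X_{1..n} => (m i == 0%N) && (m j == 0%N)) (msupp f).
  apply: contraT => /hasPn f_ij.
  have : ideal2 ('X_i : {mpoly k[n]}) 'X_j 1.
    apply/colon_f => u v e_uv; rewrite mul1r.
    have [uv_ij|/(cov' _ _ e_uv)//] := eqVneq [set u; v] [set i; j].
    apply: ideal2X_set2 (esym uv_ij) _.
    by apply/ideal2XP => m /f_ij; rewrite negb_and.
  by move/ideal2XP/(_ 0%MM); rewrite msupp1 mem_head !mnm0E => /(_ isT).
case/andP=> mi mj; exists m => //; split=> [||u v e_uv].
- by rewrite inE mi.
- by rewrite inE mj.
- have [|/(cov' _ _ e_uv)/ideal2XP/(_ m mf)] := eqVneq; first by rewrite !orbT.
  by rewrite !inE orbF.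
Qed.

End VariableIdeals.

Lemma card_msupp_leq_mdeg n (m : 'X_{1..n}) :
  (#|[set w | m w != 0%N]| <= mdeg m)%N.
Proof.
rewrite mdegE -sum1_card big_mkcond leq_sum // => w _.
by rewrite inE; case: (m w).
Qed.

Theorem lemma2p5 (k : fieldType) (n : nat) (e : rel 'I_n)
    (e_sym : ssrbool.symmetric e) (e_irr : irreflexive e)
    (e_noniso : forall v : 'I_n, ~~ isolated e v)
    (i j : 'I_n) (e_ij : e i j) :
  local_v_number (cover_ideal k e) (ideal2 ('X_i : {mpoly k[n]}) ('X_j : {mpoly k[n]}))
    (deg e i + deg e j - 2 - #|nbr e i :&: nbr e j|
     + tau (del_vertices e (closed_nbrs e [set i; j])))%N.
Proof.
rewrite -card_closed_nbrs_edge //; split.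
  have [U covU <-] := cover_all_but_exists _ _ e_sym e_irr _ _ e_ij.
  exists 'X_[mesym1 U]; last exact: colon_cover_ideal_mesym1.
  by rewrite dhomogX /= mdeg_mesym1.
move=> d [f /dhomogP f_homog /colon_cover_ideal_msupp [] // m mf covm].
(* By homogeneity [d] is the degree of [m], which is at least the size of its support. *)
rewrite -(f_homog m mf); apply: leq_trans (card_msupp_leq_mdeg _ m).
exact: leq_card_cover_all_but.
Qed.
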